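(* Let $\mathcal{I}$ be an instance of FZA on a path $T$ with edges $e^{(1)},\dots,e^{(n-1)}$ (from left to right), and let $\ell=u_{\max}$. Then the optimal revenue of $\mathcal{I}$ equals $\max_{(c_1,\dots,c_{\ell+1})} R(e^{(n-1)},(c_1,\dots,c_{\ell+1}))$, and this value can be computed in time $n^{\mathcal{O}(\ell)}$. Consequently, FZA on paths is in XP when parameterized by $u_{\max}$.
   Context: FZA: given a tree $T=(V,E)$ with $n=|V|$, a non-decreasing concave $f\colon\mathbb{N}_0\to\mathbb{R}_{\ge0}$ and commodities $i\in[k]$ with path $P_i\subseteq E$, bound $u_i\in\mathbb{N}_0$ and weight $w_i\in\mathbb{N}$, maximize $\sum_i\mathrm{rev}_i(F)$ over $F\subseteq E$, where $\mathrm{rev}_i(F)=w_if(|P_i\cap F|)$ if $|P_i\cap F|\le u_i$ and $0$ otherwise. $u_{\max}=\max_i u_i$. The path is artificially extended on the left by edges $e^{(-\ell)},\dots,e^{(0)}$ used by no commodity and regarded as cut. The subinstance up to $e^{(j)}$ consists of the subpath $e^{(1)},\dots,e^{(j)}$ and the commodities whose leftmost edge is $e^{(j)}$ or to its left (with unchanged $u_i,w_i$). $R(e^{(j)},(c_1,\dots,c_{\ell+1}))$ denotes the maximum revenue obtainable from the subinstance up to $e^{(j)}$ among all solutions whose $\ell+1$ rightmost cuts among edges up to and including $e^{(j)}$ are $c_1,\dots,c_{\ell+1}$ (left to right). A parameterized problem is in XP if it is solvable in time $n^{g(\ell)}$ for some function $g$ of the parameter $\ell$.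
   Formalization: The running time is proved as C·(k + n^{Cℓ}) steps on a unit-cost real RAM instead of n^{O(ℓ)}: with n = |V| and the number k of commodities unbounded in n, merely reading the k weights already exceeds n^{O(ℓ)}. *)

(* Defs.v *)
From mathcomp Require Import all_boot all_order all_algebra.
From mathcomp Require Import reals constructive_ereal.

Set Implicit Arguments.
Unset Strict Implicit.
Unset Printing Implicit Defensive.

Import Order.TTheory GRing.Theory Num.Theory.
Local Open Scope ring_scope.

Definition rev (R : realType) (E : finType) (f : nat -> R)
    (P : {set E}) (u w : nat) (F : {set E}) : R :=
  if (#|P :&: F| <= u)%N then w%:R * f #|P :&: F| else 0.

(* An instance on the path with n = fza_m + 1 vertices. The edge set is
   'I_fza_m, and x : 'I_fza_m stands for e^(x + 1). Since a commodity has a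
   leftmost edge, its path is nonempty and is given by its two extreme edges. *)
Record fza_path (R : realType) := FzaPath {
  fza_m : nat;
  fza_f : nat -> R;
  fza_f_ge0 : forall a, 0 <= fza_f a;
  fza_f_nondecreasing : forall a b, (a <= b)%N -> fza_f a <= fza_f b;
  fza_f_concave : forall a,
    fza_f a.+2 - fza_f a.+1 <= fza_f a.+1 - fza_f a;
  fza_k : nat;
  fza_left : 'I_fza_k -> 'I_fza_m;
  fza_right : 'I_fza_k -> 'I_fza_m;
  fza_left_right : forall i, (fza_left i <= fza_right i)%N;
  fza_u : 'I_fza_k -> nat;
  fza_w : 'I_fza_k -> nat;
  fza_w_gt0 : forall i, (0 < fza_w i)%N
}.

Section Fza.
Variables (R : realType) (I : fza_path R).

Definition fza_n : nat := (fza_m I).+1.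

Definition fza_P (i : 'I_(fza_k I)) : {set 'I_(fza_m I)} :=
  [set x : 'I_(fza_m I) | (fza_left i <= x <= fza_right i)%N].

Definition umax : nat := (\max_(i < fza_k I) fza_u i)%N.

Definition revenue (F : {set 'I_(fza_m I)}) : R :=
  \sum_(i < fza_k I) rev (fza_f I) (fza_P i) (fza_u i) (fza_w i) F.

Definition opt_revenue : R :=
  \big[Num.max/revenue set0]_(F : {set 'I_(fza_m I)}) revenue F.

(* {e^(1), ..., e^(j)} *)
Definition edges_upto (j : nat) : {set 'I_(fza_m I)} :=
  [set x : 'I_(fza_m I) | (x < j)%N].

(* Revenue of F in the subinstance up to e^(j); x.+1 <= j is "the leftmost
   edge e^(x + 1) of commodity i is e^(j) or to its left". *)
Definition sub_revenue (j : nat) (F : {set 'I_(fza_m I)}) : R :=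
  \sum_(i < fza_k I | ((fza_left i).+1 <= j)%N)
     rev (fza_f I) (fza_P i :&: edges_upto j) (fza_u i) (fza_w i) F.

(* The extended path e^(-l), ..., e^(0), e^(1), ..., e^(n - 1), l = umax:
   p : ext_edge stands for e^(p - l). *)
Definition ext_edge := 'I_(umax + fza_n).

Definition is_cut (F : {set 'I_(fza_m I)}) (p : ext_edge) : bool :=
  (p <= umax)%N || [exists x in F, p == (umax + x.+1)%N :> nat].

Definition rightmost_cuts (j : nat) (F : {set 'I_(fza_m I)}) : seq ext_edge :=
  let s := [seq p <- enum 'I_(umax + fza_n) | is_cut F p & (p <= umax + j)%N] in
  drop (size s - umax.+1) s.

(* R(e^(j), c); it is -oo when no solution has rightmost cuts c. *)
Definition Rmax (j : nat) (c : (umax.+1).-tuple ext_edge) : \bar R :=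
  \big[maxe/-oo%E]_(F : {set 'I_(fza_m I)} |
      (F \subset edges_upto j) && (rightmost_cuts j F == c :> seq _))
    (sub_revenue j F)%:E.

End Fza.

(* Time is counted on a real RAM: WHILE programs over finitely many unbounded
   arrays of naturals and of reals, with indirect addressing. Naturals only have
   +, truncated - and <=; reals have +, -, *, <= and the constants 0 and 1, so
   that no information can be hidden in a real constant of a program. *)

Inductive nexp : Type :=
| NConst of nat
| NGet of nat & nexp (* array, index *)
| NAdd of nexp & nexp
| NSub of nexp & nexp.

Inductive rexp : Type :=
| RZero
| ROne
| RGet of nat & nexp
| RAdd of rexp & rexp
| RSub of rexp & rexp
| RMul of rexp & rexp.

Inductive bexp : Type :=
| NLe of nexp & nexp
| RLe of rexp & rexp
| BNot of bexp
| BAnd of bexp & bexp.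

Inductive cmd : Type :=
| Skip
| NSet of nat & nexp & nexp (* array, index, value *)
| RSet of nat & nexp & rexp
| Seq of cmd & cmd
| If of bexp & cmd & cmd
| While of bexp & cmd.

Record memory (R : realType) := Memory {
  nmem : nat -> nat -> nat; (* array, index *)
  rmem : nat -> nat -> R
}.

Definition upd (T : Type) (h : nat -> nat -> T) (a i : nat) (v : T) :
    nat -> nat -> T :=
  fun b j => if (b == a) && (j == i) then v else h b j.

Section Semantics.
Variable R : realType.

Fixpoint neval (s : memory R) (e : nexp) : nat :=
  match e with
  | NConst c => c
  | NGet a e1 => nmem s a (neval s e1)
  | NAdd e1 e2 => (neval s e1 + neval s e2)%N
  | NSub e1 e2 => (neval s e1 - neval s e2)%N
  end.

Fixpoint reval (s : memory R) (e : rexp) : R :=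
  match e with
  | RZero => 0
  | ROne => 1
  | RGet a e1 => rmem s a (neval s e1)
  | RAdd e1 e2 => reval s e1 + reval s e2
  | RSub e1 e2 => reval s e1 - reval s e2
  | RMul e1 e2 => reval s e1 * reval s e2
  end.

Fixpoint beval (s : memory R) (b : bexp) : bool :=
  match b with
  | NLe e1 e2 => (neval s e1 <= neval s e2)%N
  | RLe e1 e2 => reval s e1 <= reval s e2
  | BNot b1 => ~~ beval s b1
  | BAnd b1 b2 => beval s b1 && beval s b2
  end.

(* exec p s t s': started in s, p halts in s' after t steps. Assignments and
   tests are charged one step; the expressions of a fixed program have bounded
   size, so charging every operation would only change t by a constant factor. *)
Inductive exec : cmd -> memory R -> nat -> memory R -> Prop :=
| ExecSkip s :
    exec Skip s 1 s
| ExecNSet a i e s :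
    exec (NSet a i e) s 1
      (Memory (upd (nmem s) a (neval s i) (neval s e)) (rmem s))
| ExecRSet a i e s :
    exec (RSet a i e) s 1
      (Memory (nmem s) (upd (rmem s) a (neval s i) (reval s e)))
| ExecSeq p q s1 s2 s3 t1 t2 :
    exec p s1 t1 s2 -> exec q s2 t2 s3 -> exec (Seq p q) s1 (t1 + t2) s3
| ExecIfTrue b p q s t s' :
    beval s b -> exec p s t s' -> exec (If b p q) s t.+1 s'
| ExecIfFalse b p q s t s' :
    ~~ beval s b -> exec q s t s' -> exec (If b p q) s t.+1 s'
| ExecWhileFalse b p s :
    ~~ beval s b -> exec (While b p) s 1 s
| ExecWhileTrue b p s1 s2 s3 t1 t2 :
    beval s1 b -> exec p s1 t1 s2 -> exec (While b p) s2 t2 s3 ->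
    exec (While b p) s1 (t1 + t2).+1 s3.

End Semantics.

Record param_problem (R : realType) := ParamProblem {
  pp_inst : Type;
  pp_size : pp_inst -> nat;
  pp_param : pp_inst -> nat;
  pp_input : pp_inst -> memory R;
  pp_solved : pp_inst -> memory R -> Prop (* correct final memories *)
}.

Definition in_XP (R : realType) (Q : param_problem R) : Prop :=
  exists (p : cmd) (g : nat -> nat), forall x : pp_inst Q,
  exists (t : nat) (s : memory R),
    [/\ exec p (pp_input x) t s, pp_solved x s
      & (t <= pp_size x ^ g (pp_param x))%N].

Section Problems.
Variable R : realType.

(* Input format; cells not mentioned are 0.
     naturals, array 0:    n, k
     naturals, arrays 1-3: for each commodity, the numbers (from 1 to n - 1)
                           of its leftmost and rightmost edge, and u_i
     reals, array 0:       f(0), ..., f(n - 1)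
     reals, array 1:       the weights w_i *)
Definition fza_nat_input (I : fza_path R) (a : nat) : seq nat :=
  match a with
  | 0 => [:: fza_n I; fza_k I]
  | 1 => [seq (fza_left i).+1 | i <- enum 'I_(fza_k I)]
  | 2 => [seq (fza_right i).+1 | i <- enum 'I_(fza_k I)]
  | 3 => [seq fza_u i | i <- enum 'I_(fza_k I)]
  | _ => [::]
  end%N.

Definition fza_real_input (I : fza_path R) (a : nat) : seq R :=
  match a with
  | 0 => [seq fza_f I d | d <- iota 0 (fza_n I)]
  | 1 => [seq (fza_w i)%:R | i <- enum 'I_(fza_k I)]
  | _ => [::]
  end%N.

Definition fza_input (I : fza_path R) : memory R :=
  Memory (fun a i => nth 0%N (fza_nat_input I a) i)
         (fun a i => nth 0 (fza_real_input I a) i).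

(* Number of input cells. *)
Definition fza_size (I : fza_path R) : nat :=
  (2 + fza_n I + 4 * fza_k I)%N.

(* FZA on paths as the problem of computing the optimal revenue, which is to
   be left in cell 0 of real array 0. *)
Definition FZA_paths : param_problem R :=
  @ParamProblem R (fza_path R) fza_size (@umax R) fza_input
    (fun I s => rmem s 0%N 0%N = opt_revenue I).

(* The decision version: given also a threshold K (in cell 0 of real array 2),
   is there a solution of revenue at least K? The answer 1 (yes) or 0 (no) is
   to be left in cell 0 of natural array 0. *)
Definition FZA_paths_dec : param_problem R :=
  @ParamProblem R (fza_path R * R)%type
    (fun x => (fza_size x.1).+1)
    (fun x => umax x.1)
    (fun x => Memory (nmem (fza_input x.1))
                     (upd (rmem (fza_input x.1)) 2 0 x.2))
    (fun x s => nmem s 0%N 0%N =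
       [exists F : {set 'I_(fza_m x.1)}, x.2 <= revenue F] :> nat).

End Problems.

(* Main.v *)
(* A solution is scanned from left to right, and a commodity is paid when the
   scan reaches its right end. Only commodities with at most l = umax cuts pay,
   so the number of cuts since the left end, truncated at l + 1, suffices, and
   it can be read off the last l + 1 cuts; these form one of n^(l + 1) states,
   coded as a numeral in base n whose least significant digit is the oldest cut.
   Going through the edges from right to left, the best future income of a
   state x is the maximum over keeping x and pushing the current edge onto it.
   Counts never exceed n - 1, so each u_i may be replaced by min(u_i, n - 1);
   the weights of commodities with equal ends and equal bound are then summed
   up in O(k) steps, after which the running time no longer depends on k. If
   l = 0, cutting nothing is optimal and O(k) steps suffice. *)
Require Import Defs.
From mathcomp Require Import all_boot all_order all_algebra.
From mathcomp Require Import reals constructive_ereal.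
From mathcomp Require Import zify.

Set Implicit Arguments.
Unset Strict Implicit.
Unset Printing Implicit Defensive.

Import Order.TTheory GRing.Theory Num.Theory.

(** * Timed weakest preconditions *)

Fixpoint nreads (e : nexp) : seq nat :=
  match e with
  | NConst _ => [::]
  | NGet a e1 => a :: nreads e1
  | NAdd e1 e2 | NSub e1 e2 => nreads e1 ++ nreads e2
  end.

Fixpoint nwrites (c : cmd) : seq nat :=
  match c with
  | NSet a _ _ => [:: a]
  | Seq p q | If _ p q => nwrites p ++ nwrites q
  | While _ p => nwrites p
  | _ => [::]
  end.

Fixpoint rwrites (c : cmd) : seq nat :=
  match c with
  | RSet a _ _ => [:: a]
  | Seq p q | If _ p q => rwrites p ++ rwrites q
  | While _ p => rwrites p
  | _ => [::]
  end.

Section Wp.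
Variable R : realType.
Implicit Types (s : memory R) (Q : memory R -> Prop).

Definition set_nat s a i v : memory R := Memory (upd (nmem s) a i v) (rmem s).
Definition set_real s a i v : memory R := Memory (nmem s) (upd (rmem s) a i v).

Definition wp (c : cmd) (T : nat) Q s : Prop :=
  exists t s', [/\ exec c s t s', (t <= T) & Q s'].

Definition same (W V : seq nat) s s' : Prop :=
  (forall a i, a \notin W -> nmem s' a i = nmem s a i) /\
  (forall a i, a \notin V -> rmem s' a i = rmem s a i).

Lemma same_trans W V s1 s2 s3 :
  same W V s1 s2 -> same W V s2 s3 -> same W V s1 s3.
Proof.
move=> [n1 r1] [n2 r2]; split=> a i aW; first by rewrite n2 // n1.
by rewrite r2 // r1.
Qed.

Lemma same_sub W V W' V' s1 s2 :
  {subset W <= W'} -> {subset V <= V'} -> same W V s1 s2 -> same W' V' s1 s2.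
Proof.
move=> sW sV [n1 r1]; split=> a i aW.
  by rewrite n1 //; apply: contra aW; apply: sW.
by rewrite r1 //; apply: contra aW; apply: sV.
Qed.

Lemma exec_same c s t s' :
  exec c s t s' -> same (nwrites c) (rwrites c) s s'.
Proof.
elim=> {c s t s'} //=.
- move=> a i e s; split=> // b j; rewrite inE /upd /=.
  by move=> /negbTE ->.
- move=> a i e s; split=> // b j; rewrite inE /upd /=.
  by move=> /negbTE ->.
- move=> p q s1 s2 s3 t1 t2 _ h1 _ h2; apply: same_trans (_ : same _ _ s1 s2) _.
    by apply: same_sub h1 => a ain; rewrite mem_cat ain.
  by apply: same_sub h2 => a ain; rewrite mem_cat ain orbT.
- move=> b p q s t s' _ _; apply: same_sub => a ain; by rewrite mem_cat ain.
- move=> b p q s t s' _ _; apply: same_sub => a ain; by rewrite mem_cat ain orbT.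
- move=> b p s1 s2 s3 t1 t2 _ _ h1 _ h2; exact: same_trans h1 h2.
Qed.

Lemma neval_same W V s s' e :
  all (fun a => a \notin W) (nreads e) -> same W V s s' ->
  neval s' e = neval s e.
Proof.
move=> + [h _]; elim: e => //= [a e IH /andP[aW eW]|e1 IH1 e2 IH2|e1 IH1 e2 IH2].
- by rewrite h // IH.
- by rewrite all_cat => /andP[h1 h2]; rewrite IH1 // IH2.
- by rewrite all_cat => /andP[h1 h2]; rewrite IH1 // IH2.
Qed.

Lemma wp_weaken c T T' Q Q' s :
  wp c T Q s -> (T <= T') ->
  (forall s', same (nwrites c) (rwrites c) s s' -> Q s' -> Q' s') ->
  wp c T' Q' s.
Proof.
move=> [t [s' [h1 h2 h3]]] TT QQ; exists t, s'; split=> //.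
  exact: leq_trans h2 TT.
by apply: QQ => //; apply: exec_same h1.
Qed.

Lemma wp_le T c T' Q s : wp c T Q s -> (T <= T') -> wp c T' Q s.
Proof. by move=> h hT; apply: wp_weaken h hT _. Qed.

Lemma wp_skip Q s : Q s -> wp Skip 1 Q s.
Proof. by move=> h; exists 1, s; split=> //; constructor. Qed.

Lemma wp_nset a i e Q s :
  Q (set_nat s a (neval s i) (neval s e)) -> wp (NSet a i e) 1 Q s.
Proof. by move=> h; eexists _, _; split; [constructor| |exact: h]. Qed.

Lemma wp_rset a i e Q s :
  Q (set_real s a (neval s i) (reval s e)) -> wp (RSet a i e) 1 Q s.
Proof. by move=> h; eexists _, _; split; [constructor| |exact: h]. Qed.

Lemma wp_seq p q T1 T2 Q s :
  wp p T1 (wp q T2 Q) s -> wp (Seq p q) (T1 + T2) Q s.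
Proof.
move=> [t1 [s1 [e1 l1 [t2 [s2 [e2 l2 h]]]]]]; exists (t1 + t2), s2.
by split=> //; [apply: ExecSeq e1 e2|apply: leq_add].
Qed.

Lemma wp_if b p q T Q s :
  (beval s b -> wp p T Q s) -> (~~ beval s b -> wp q T Q s) ->
  wp (If b p q) T.+1 Q s.
Proof.
case: (boolP (beval s b)) => hb => [/(_ isT) h _|_ /(_ isT) h];
  case: h => t [s' [e l h]]; exists t.+1, s'; split=> //.
  exact: ExecIfTrue.
exact: ExecIfFalse.
Qed.

Definition cell v := NGet v (NConst 0).
Definition assign v e := NSet v (NConst 0) e.
Definition for_loop v e c :=
  Seq (assign v (NConst 0))
    (While (BNot (NLe e (cell v)))
       (Seq c (assign v (NAdd (cell v) (NConst 1))))).

Lemma wp_for v e c N T (Inv : nat -> memory R -> Prop) Q s :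
  all (fun a => a \notin v :: nwrites c) (nreads e) -> v \notin nwrites c ->
  neval s e = N -> Inv 0 (set_nat s v 0 0) ->
  (forall i s', (i < N) -> same (v :: nwrites c) (rwrites c) s s' ->
     nmem s' v 0 = i -> Inv i s' ->
     wp c T (fun s'' => Inv i.+1 (set_nat s'' v 0 i.+1)) s') ->
  (forall s', same (v :: nwrites c) (rwrites c) s s' -> Inv N s' -> Q s') ->
  wp (for_loop v e c) (N * (T + 2) + 2) Q s.
Proof.
move=> er vc eN I0 IS QN; rewrite addnC -[2]/(1 + 1) -addnA; apply: wp_seq.
apply: wp_nset; rewrite /=; set s1 := set_nat _ _ _ _ in I0 *.
have h1 : same (v :: nwrites c) (rwrites c) s s1.
  split=> // a i; rewrite inE negb_or /s1 /= /upd => /andP[/negbTE -> _] //.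
have v1 : nmem s1 v 0 = (N - N) by rewrite /s1 /= /upd !eqxx subnn.
rewrite -[0](subnn N) in I0.
suff H d s' : (d <= N) -> same (v :: nwrites c) (rwrites c) s s' ->
   nmem s' v 0 = (N - d) -> Inv (N - d) s' ->
   wp (While (BNot (NLe e (cell v)))
       (Seq c (assign v (NAdd (cell v) (NConst 1))))) (1 + d * (T + 2)) Q s'.
  exact: H.
elim: d s' => [|d IH] s' dN hs hv hI.
  exists 1, s'; split=> //; last by apply: QN => //; rewrite -[N]subn0.
  apply: ExecWhileFalse; rewrite /= (neval_same er hs) eN hv.
  by rewrite subn0 negbK.
have [|t [s2 [e2 l2 h2]]] := IS (N - d.+1) s' _ hs hv hI; first by lia.
have sm2 := exec_same e2.
have v2 : nmem s2 v 0 = (N - d.+1) by rewrite sm2.1.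
have Ed : ((N - d.+1).+1 = N - d) by lia.
case: (IH (set_nat s2 v 0 (N - d))).
- by lia.
- apply: same_trans hs _; split=> a i.
    rewrite inE negb_or /= /upd => /andP[/negbTE -> ?]; by rewrite sm2.1.
  by move=> ?; rewrite /= sm2.2.
- by rewrite /= /upd !eqxx.
- by rewrite -Ed.
move=> t' [s3 [e3 l3 h3]].
exists (t + 1 + t').+1, s3; split=> //; last by lia.
apply: ExecWhileTrue e3.
  by rewrite /= (neval_same er hs) eN hv -ltnNge; lia.
apply: ExecSeq e2 _; rewrite -Ed.
have -> : set_nat s2 v 0 (N - d.+1).+1 =
   Memory (upd (nmem s2) v (neval s2 (NConst 0))
          (neval s2 (NAdd (cell v) (NConst 1)))) (rmem s2).
  by rewrite /= v2 addn1.
exact: ExecNSet.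
Qed.

End Wp.

(** * The program *)

(* v_mul and v_div tabulate x * n and x / n, which the machine lacks; v_pow and
   v_top hold the powers of n bounding a state and weighing its newest cut. *)
Local Notation v_i := 4 (only parsing).
Local Notation v_L := 5 (only parsing).
Local Notation v_a := 6 (only parsing).
Local Notation v_b := 7 (only parsing).
Local Notation v_pow := 8 (only parsing).
Local Notation v_top := 9 (only parsing).
Local Notation v_q := 10 (only parsing).
Local Notation v_y := 11 (only parsing).
Local Notation v_mul := 12 (only parsing).
Local Notation v_div := 13 (only parsing).
Local Notation v_step := 14 (only parsing).
Local Notation v_p := 15 (only parsing).
Local Notation v_s := 16 (only parsing).
Local Notation v_l := 17 (only parsing).
Local Notation v_c := 18 (only parsing).
Local Notation v_x := 19 (only parsing).
Local Notation v_u := 20 (only parsing).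
Local Notation v_j := 21 (only parsing).
Local Notation r_f := 0 (only parsing).
Local Notation r_w := 1 (only parsing).
Local Notation r_agg := 3 (only parsing).
Local Notation r_val := 4 (only parsing).
Local Notation r_acc := 5 (only parsing).

Definition e_n := NGet 0 (NConst 0).
Definition e_k := NGet 0 (NConst 1).
Definition e_m := NSub e_n (NConst 1).
(* a - (a - b) = min(a, b) and a + (b - a) = max(a, b) for truncated subtraction. *)
Definition e_cap :=
  NSub (NGet 3 (cell v_i)) (NSub (NGet 3 (cell v_i)) e_m).
Definition e_mul e := NGet v_mul e.
Definition e_div e := NGet v_div e.

Definition prog_cap :=
  Seq (assign v_L (NConst 0))
    (for_loop v_i e_k
       (assign v_L (NAdd (cell v_L) (NSub e_cap (cell v_L))))).

Definition prog_trivial :=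
  Seq (for_loop v_i e_k
         (RSet r_val (NConst 0)
            (RAdd (RGet r_val (NConst 0))
               (RMul (RGet r_w (cell v_i)) (RGet r_f (NConst 0))))))
    (RSet 0 (NConst 0) (RGet r_val (NConst 0))).

Definition prog_pow :=
  Seq (assign v_pow (NConst 1))
    (for_loop v_a (NAdd (cell v_L) (NConst 1))
       (Seq (assign v_top (cell v_pow))
          (Seq (assign v_pow (NConst 0))
             (for_loop v_b e_n
                (assign v_pow (NAdd (cell v_pow) (cell v_top))))))).

Definition prog_tables :=
  Seq (assign v_y (NConst 0))
    (for_loop v_q (cell v_pow)
       (Seq (NSet v_mul (cell v_q) (cell v_y))
          (for_loop v_b e_n
             (Seq (NSet v_div (cell v_y) (cell v_q))
                (assign v_y (NAdd (cell v_y) (NConst 1))))))).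

Definition e_slot := NAdd (e_mul
  (NAdd (e_mul (NSub (NGet 1 (cell v_i)) (NConst 1))) (NGet 2 (cell v_i))))
  e_cap.

Definition prog_aggregate :=
  for_loop v_i e_k
    (RSet r_agg e_slot (RAdd (RGet r_agg e_slot) (RGet r_w (cell v_i)))).

Definition prog_count :=
  Seq (assign v_c (NConst 0))
    (Seq (assign v_x (cell v_s))
       (for_loop v_a (NAdd (cell v_L) (NConst 1))
          (Seq
             (assign v_c
                (NAdd (cell v_c)
                   (NSub (NConst 1)
                      (NSub (NConst 1)
                         (NSub
                            (NSub (cell v_x) (e_mul (e_div (cell v_x))))
                            (cell v_l))))))
             (assign v_x (e_div (cell v_x)))))).

Definition e_slot_at :=
  NAdd (e_mul (NAdd (e_mul (cell v_l)) (cell v_j))) (cell v_u).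

Definition prog_credit_row :=
  for_loop v_u e_n
    (If (NLe (cell v_c) (cell v_u))
       (RSet r_acc (NConst 0)
          (RAdd (RGet r_acc (NConst 0))
             (RMul (RGet r_agg e_slot_at) (RGet r_f (cell v_c)))))
       Skip).

Definition prog_credit :=
  Seq (RSet r_acc (NConst 0) RZero)
    (for_loop v_l e_n (Seq prog_count prog_credit_row)).

Definition prog_credits :=
  for_loop v_s (cell v_pow)
    (Seq prog_credit
       (RSet r_val (cell v_s)
          (RAdd (RGet r_val (cell v_s)) (RGet r_acc (NConst 0))))).

Definition e_shift := NAdd (e_div (cell v_s)) (cell v_p).

Definition prog_choose :=
  for_loop v_s (cell v_p)
    (If (RLe (RGet r_val (cell v_s)) (RGet r_val e_shift))
       (RSet r_val (cell v_s) (RGet r_val e_shift))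
       Skip).

Definition prog_offset :=
  Seq (assign v_j (NSub e_m (cell v_step)))
    (Seq (assign v_p (NConst 0))
      (for_loop v_b (cell v_j)
         (assign v_p (NAdd (cell v_p) (cell v_top))))).

Definition prog_edge := Seq prog_offset (Seq prog_credits prog_choose).

Definition prog_dp :=
  Seq prog_pow
    (Seq prog_tables
       (Seq prog_aggregate
          (Seq (for_loop v_step e_m prog_edge)
             (RSet 0 (NConst 0) (RGet r_val (NConst 0)))))).

Definition fza_prog :=
  Seq prog_cap (If (NLe (cell v_L) (NConst 0)) prog_trivial prog_dp).

Ltac frame H := repeat match goal with
  | |- context [nmem ?s ?a ?i] => rewrite (proj1 H a i (erefl true))
  | |- context [rmem ?s ?a ?i] => rewrite (proj2 H a i (erefl true))
  end; rewrite /= ?/upd /=.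

Section Program.
Variables (R : realType) (n k : nat) (lft rgt uu : nat -> nat) (f w : nat -> R).
Hypothesis n_gt0 : 0 < n.
Hypothesis lftP : forall i, i < k -> lft i - 1 < n.
Hypothesis rgtP : forall i, i < k -> rgt i < n.

Record inputs (s : memory R) : Prop := Inputs {
  inputs_n : nmem s 0 0 = n;
  inputs_k : nmem s 0 1 = k;
  inputs_lft : forall i, nmem s 1 i = lft i;
  inputs_rgt : forall i, nmem s 2 i = rgt i;
  inputs_u : forall i, nmem s 3 i = uu i;
  inputs_f : forall i, rmem s 0 i = f i;
  inputs_w : forall i, rmem s 1 i = w i }.

Lemma inputs_same W V s s' :
  same W V s s' -> all (fun a => 3 < a) W -> all (fun a => 1 < a) V ->
  inputs s -> inputs s'.
Proof.
move=> [h1 h2] hW hV [i1 i2 i3 i4 i5 i6 i7].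
have nW a : a < 4 -> a \notin W.
  by move=> a4; apply/negP=> /(allP hW); rewrite ltnNge -ltnS a4.
have nV a : a < 2 -> a \notin V.
  by move=> a4; apply/negP=> /(allP hV); rewrite ltnNge -ltnS a4.
by split=> *; rewrite ?h1 ?h2 ?nW ?nV.
Qed.

Definition cap i := minn (uu i) n.-1.
Definition depth := \max_(i < k) cap i.
Definition slot i := ((lft i - 1) * n + rgt i) * n + cap i.
Definition agg z : R := (\sum_(i < k | slot i == z) w i)%R.

Fixpoint digits_above d l x :=
  if d is d'.+1 then (l < x %% n) + digits_above d' l (x %/ n) else 0.

Local Notation states := (n ^ depth.+1).
Local Notation cnt l x := (digits_above depth.+1 l x).

Definition credit_row j x l : R :=
  (\sum_(u < n) if (cnt l x <= u)%N then agg ((l * n + j) * n + u)%N * f (cnt l x)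
                else 0)%R.
Definition credit j x : R := (\sum_(l < n) credit_row j x l)%R.

Definition push j x := x %/ n + j * n ^ depth.

Fixpoint best t x : R :=
  if t is t'.+1 then
    let j := n.-1 - t' in
    Order.max (credit j x + best t' x)%R
              (credit j (push j x) + best t' (push j x))%R
  else 0%R.

Record tables (s : memory R) : Prop := Tables {
  tables_mul : forall q, q < states -> nmem s v_mul q = q * n;
  tables_div : forall y, y < states -> nmem s v_div y = y %/ n;
  tables_L : nmem s v_L 0 = depth;
  tables_pow : nmem s v_pow 0 = states;
  tables_top : nmem s v_top 0 = n ^ depth }.

Lemma tables_same W V s s' :
  same W V s s' ->
  all (fun a => a \notin [:: v_mul; v_div; v_L; v_pow; v_top]) W ->
  tables s -> tables s'.
Proof.
move=> [h1 h2] hW [i1 i2 i3 i4 i5].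
have nW a : a \in [:: v_mul; v_div; v_L; v_pow; v_top] -> a \notin W.
  by move=> ain; apply/negP=> /(allP hW); rewrite ain.
by split=> *; rewrite ?h1 ?nW //; [apply: i1|apply: i2].
Qed.

Lemma inputs_set_nat a i v s :
  3 < a -> inputs s -> inputs (set_nat s a i v).
Proof. by case: a => [|[|[|[|a]]]] // _ []; split. Qed.

Lemma inputs_set_real a i v s :
  1 < a -> inputs s -> inputs (set_real s a i v).
Proof. by case: a => [|[|a]] // _ []; split. Qed.

Lemma wp_cap s : inputs s ->
  wp prog_cap (3 * k + 3) (fun s' => nmem s' v_L 0 = depth) s.
Proof.
move=> hi; eapply wp_le.
  apply/wp_seq/wp_nset/(wp_for (N := k) (T := 1)
    (Inv := fun i s' => nmem s' v_L 0 = \max_(j < i) cap j)) => //=.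
  - by rewrite /upd /= inputs_k.
  - by rewrite /upd /= big_ord0.
  - move=> i s' ik hs hv hI; apply: wp_nset; rewrite /= /upd /=.
    have hi' := inputs_same hs erefl erefl (inputs_set_nat (a := v_L) 0 0 erefl hi).
    by rewrite big_ord_recr /= -hI hv inputs_u // inputs_n // /cap; lia.
lia.
Qed.

Lemma wp_trivial s : inputs s -> rmem s r_val 0 = 0%R ->
  wp prog_trivial (3 * k + 3)
    (fun s' => rmem s' 0 0 = (\sum_(i < k) w i * f 0)%R) s.
Proof.
move=> hi h0; eapply wp_le.
  apply/wp_seq/(wp_for (N := k) (T := 1)
    (Inv := fun i s' => rmem s' r_val 0 = (\sum_(j < i) w j * f 0)%R)) => //=.
  - by rewrite inputs_k.
  - by rewrite big_ord0.
  - move=> i s' ik hs hv hI; apply: wp_rset; rewrite /= /upd /=.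
    have hi' := inputs_same hs erefl erefl hi.
    by rewrite big_ord_recr /= -hI hv inputs_w // inputs_f.
  - by move=> s' hs hI; apply: wp_rset; rewrite /= /upd /=.
lia.
Qed.

Lemma wp_pow s : inputs s -> nmem s v_L 0 = depth ->
  wp prog_pow (depth.+1 * (3 * n + 6) + 3)
    (fun s' => nmem s' v_pow 0 = states /\ nmem s' v_top 0 = n ^ depth) s.
Proof.
move=> hi hL; eapply wp_le.
  apply/wp_seq/wp_nset/(wp_for (N := depth.+1) (T := 1 + (1 + (n * (1 + 2) + 2)))
    (Inv := fun a s' => nmem s' v_pow 0 = n ^ a /\
                        (0 < a -> nmem s' v_top 0 = n ^ a.-1))) => //=.
  - by rewrite /upd /= hL addn1.
  - move=> a s' ad hs hv [h1 h2].
    apply/wp_seq/wp_nset/wp_seq/wp_nset/(wp_for (N := n)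
      (Inv := fun b s1 => nmem s1 v_pow 0 = b * n ^ a /\
                          nmem s1 v_top 0 = n ^ a)) => //=.
    + by rewrite /upd /=; frame hs; rewrite /= inputs_n.
    + move=> b s1 bn hs1 hv1 [h3 h4]; apply: wp_nset; rewrite /= /upd /=.
      by rewrite h3 h4 mulSn addnC.
    + by move=> s1 hs1 [h3 h4]; rewrite /upd /= h3 h4 expnS.
  - by move=> s' hs [-> ->].
lia.
Qed.

Lemma wp_tables s : inputs s -> nmem s v_L 0 = depth ->
  nmem s v_pow 0 = states -> nmem s v_top 0 = n ^ depth ->
  wp prog_tables (states * (4 * n + 5) + 3) tables s.
Proof.
move=> hi hL hp ht; eapply wp_le.
  apply/wp_seq/wp_nset/(wp_for (N := states) (T := 1 + (n * (1 + 1 + 2) + 2))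
    (Inv := fun q s' => [/\ nmem s' v_y 0 = q * n,
       forall q', q' < q -> nmem s' v_mul q' = q' * n &
       forall y, y < q * n -> nmem s' v_div y = y %/ n])) => //=.
  - move=> q s' qs hs hv [h1 h2 h3].
    apply/wp_seq/wp_nset/(wp_for (N := n)
      (Inv := fun b s1 => nmem s1 v_y 0 = q * n + b /\
       forall y, y < q * n + b -> nmem s1 v_div y = y %/ n)) => //=.
    + by rewrite /upd /=; frame hs; rewrite /= inputs_n.
    + rewrite /upd /= h1 addn0; split=> // y; exact: h3.
    + move=> b s1 bn hs1 hv1 [h4 h5].
      apply/wp_seq/wp_nset/wp_nset; rewrite /= /upd /= h4.
      split=> [|y yb]; first by lia.
      have [->|yn] := eqVneq y.
        by frame hs1; rewrite /= hv divnMDl // divn_small // addn0.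
      by apply: h5; lia.
    + move=> s1 hs1 [h4 h5]; rewrite /upd /=; split.
      * by rewrite h4 mulSn addnC.
      * move=> q'; rewrite ltnS => q'q; frame hs1; rewrite /= /upd /= hv h1.
        have [-> //|nq] := eqVneq; apply: h2; lia.
      * by move=> y yq; apply: h5; lia.
  - move=> s' hs [h1 h2 h3]; split=> //.
    + by move=> y ys; apply: h3; rewrite (leq_trans ys) // leq_pmulr.
    + by frame hs.
    + by frame hs.
    + by frame hs.
lia.
Qed.

Lemma states_ge : 0 < depth -> n * n <= states.
Proof.
by move=> d0; rewrite -[n * n]/(n ^ 2) leq_pexp2l.
Qed.

Lemma slot_lt_states l j : 0 < depth -> l < n -> j < n -> l * n + j < states.
Proof.
by move=> d0 ln jn; apply: leq_trans (states_ge d0); nia.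
Qed.

Lemma n_le_states : n <= states.
Proof. by rewrite -{1}[n]expn1 leq_pexp2l. Qed.

Lemma wp_aggregate s : inputs s -> tables s -> 0 < depth ->
  (forall z, rmem s r_agg z = 0%R) ->
  wp prog_aggregate (3 * k + 2) (fun s' => forall z, rmem s' r_agg z = agg z) s.
Proof.
move=> hi ht d0 h0; eapply wp_le.
  apply/(wp_for (N := k) (T := 1)
    (Inv := fun i s' => forall z,
       rmem s' r_agg z = (\sum_(j < i | slot j == z) w j)%R)) => //=.
  - by rewrite inputs_k.
  - by move=> z; rewrite big_ord0.
  - move=> i s' ik hs hv hI; apply: wp_rset; rewrite /= /upd /=.
    have hi' := inputs_same hs erefl erefl hi.
    have ht' := tables_same hs erefl ht.
    rewrite hv inputs_w // !inputs_lft // !inputs_rgt // !inputs_u //.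
    have ls : lft i - 1 < states by apply: leq_trans (lftP ik) n_le_states.
    have ljs : (lft i - 1) * n + rgt i < states.
      by apply: slot_lt_states; [|apply: lftP|apply: rgtP].
    rewrite !inputs_n // !(tables_mul ht') // => z.
    rewrite big_mkcond big_ord_recr /= -big_mkcond /= -hI.
    have -> : ((lft i - 1) * n + rgt i) * n + (uu i - (uu i - (n - 1))) = slot i.
      by rewrite /slot /cap; lia.
    by rewrite hI eq_sym; case: eqP => [->|]; rewrite ?hI ?addr0.
lia.
Qed.

Lemma wp_count s x l : inputs s -> tables s ->
  nmem s v_s 0 = x -> nmem s v_l 0 = l -> x < states ->
  wp prog_count (4 * depth.+1 + 4) (fun s' => nmem s' v_c 0 = cnt l x) s.
Proof.
move=> hi ht hx hl xs; eapply wp_le.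
  apply/wp_seq/wp_nset/wp_seq/wp_nset/(wp_for (N := depth.+1) (T := 1 + 1)
    (Inv := fun a s' =>
       nmem s' v_c 0 + digits_above (depth.+1 - a) l (nmem s' v_x 0) = cnt l x
       /\ nmem s' v_x 0 < states)) => //=.
  - by rewrite /upd /= tables_L // addn1.
  - by rewrite /upd /= hx.
  - move=> a s' ad hs hv [h1 h2].
    apply/wp_seq/wp_nset/wp_nset; rewrite /= /upd /=.
    have ht' : tables s'.
      by apply: (tables_same hs) => //; case: ht; split.
    rewrite tables_div // tables_mul //; last exact: leq_ltn_trans (leq_div _ _) h2.
    split; last exact: leq_ltn_trans (leq_div _ _) h2.
    have -> : nmem s' v_l 0 = l by frame hs; rewrite /= /upd /=.
    have -> : nmem s' v_x 0 - nmem s' v_x 0 %/ n * n = nmem s' v_x 0 %% n.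
      by rewrite {1}(divn_eq (nmem s' v_x 0) n) addKn.
    rewrite -h1 (subSn (ad : a <= depth)) subSS /= addnA; congr (_ + _ + _).
    by case: (ltnP l) => hh; lia.
  - by move=> s' hs [h1 h2]; rewrite -h1 subnn /= addn0.
lia.
Qed.

Lemma wp_credit_row s x l j : inputs s -> tables s -> 0 < depth ->
  (forall z, rmem s r_agg z = agg z) ->
  nmem s v_c 0 = cnt l x -> nmem s v_l 0 = l -> nmem s v_j 0 = j ->
  l < n -> j < n ->
  wp prog_credit_row (4 * n + 2)
    (fun s' => rmem s' r_acc 0 = rmem s r_acc 0 + credit_row j x l)%R s.
Proof.
move=> hi ht d0 hA hc hl hj ln jn; eapply wp_le.
  apply/(wp_for (N := n) (T := 2)
    (Inv := fun i s' => rmem s' r_acc 0 = rmem s r_acc 0 +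
     \sum_(u < i) if (cnt l x <= u)%N then
        agg ((l * n + j) * n + u)%N * f (cnt l x) else 0)%R) => //=.
  - by rewrite inputs_n.
  - by rewrite big_ord0 addr0.
  - move=> u s' un hs hv hI.
    have hi' := inputs_same hs erefl erefl hi.
    have ht' := tables_same hs erefl ht.
    apply: wp_if => /=; frame hs; rewrite hv hc big_ord_recr /= => hb.
      apply: wp_rset; rewrite /= /upd /= hb hI -addrA; congr (_ + (_ + _))%R.
      have -> : nmem s' v_c 0 = cnt l x by frame hs.
      have -> : nmem s' v_l 0 = l by frame hs.
      have -> : nmem s' v_j 0 = j by frame hs.
      have ls : l < states by apply: leq_trans ln n_le_states.
      have ljs : l * n + j < states by apply: slot_lt_states.
      by rewrite hv !(tables_mul ht') ?inputs_f //; frame hs; rewrite hA.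
    by apply: wp_skip; rewrite /= (negbTE hb) addr0.
lia.
Qed.

Lemma wp_credit s x j : inputs s -> tables s -> 0 < depth ->
  (forall z, rmem s r_agg z = agg z) ->
  nmem s v_s 0 = x -> x < states -> nmem s v_j 0 = j -> j < n ->
  wp prog_credit (n * (4 * depth.+1 + 4 * n + 8) + 3)
    (fun s' => rmem s' r_acc 0 = credit j x) s.
Proof.
move=> hi ht d0 hA hx xs hj jn; eapply wp_le.
  apply/wp_seq/wp_rset/(wp_for (N := n) (T := (4 * depth.+1 + 4) + (4 * n + 2))
    (Inv := fun l s' => rmem s' r_acc 0 = \sum_(i < l) credit_row j x i)%R) => //=.
  - by rewrite inputs_n.
  - by rewrite /upd /= big_ord0.
  - move=> l s' ln hs hv hI.
    have hi' := inputs_same hs erefl erefl (inputs_set_real (a := r_acc) _ _ erefl hi).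
    have ht' : tables s'.
      by apply: (tables_same hs) => //; case: ht; split.
    apply/wp_seq/(wp_weaken (wp_count (x := x) (l := l) hi' ht' _ hv xs)) => //.
      by frame hs.
    move=> s1 hs1 hc; apply: wp_weaken (wp_credit_row (x := x) (l := l) (j := j)
       _ _ _ _ hc _ _ ln jn) _ _ => //.
    + exact: inputs_same hs1 erefl erefl hi'.
    + exact: tables_same hs1 erefl ht'.
    + by move=> z; frame hs1; frame hs; rewrite /= /upd /= hA.
    + by frame hs1.
    + by frame hs1; frame hs.
    + move=> s2 hs2 /= ->; rewrite big_ord_recr /= -hI; congr (_ + _)%R.
      by frame hs1.
lia.
Qed.

Lemma wp_credits s j : inputs s -> tables s -> 0 < depth ->
  (forall z, rmem s r_agg z = agg z) -> nmem s v_j 0 = j -> j < n ->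
  wp prog_credits (states * (n * (4 * depth.+1 + 4 * n + 8) + 6) + 2)
    (fun s' => forall x, x < states ->
       rmem s' r_val x = (rmem s r_val x + credit j x)%R) s.
Proof.
move=> hi ht d0 hA hj jn; eapply wp_le.
  apply/(wp_for (N := states) (T := (n * (4 * depth.+1 + 4 * n + 8) + 3) + 1)
    (Inv := fun i s' => forall x, rmem s' r_val x =
       if (x < i)%N then rmem s r_val x + credit j x else rmem s r_val x)%R) => //=.
  - by rewrite tables_pow.
  - move=> i s' il hs hv hI.
    have hi' := inputs_same hs erefl erefl hi.
    have ht' := tables_same hs erefl ht.
    apply/wp_seq/(wp_weaken (wp_credit (j := j) hi' ht' d0 _ hv il _ jn)) => //.
    + by move=> z; frame hs.
    + by frame hs.
    + move=> s1 hs1 hc; apply: wp_rset; rewrite /= /upd /= => x.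
      rewrite (proj1 hs1) // hv hc.
      have [->|ni] := eqVneq x i.
        by frame hs1; rewrite hI ltnn leqnn.
      frame hs1; rewrite hI; congr (if _ then _ else _).
      by rewrite [RHS]ltnS [RHS]leq_eqVlt (negbTE ni).
  - by move=> s' hs hI x xs; rewrite hI xs.
lia.
Qed.

Lemma push_lt j x : x < states -> push j x < j.+1 * n ^ depth.
Proof.
move=> xs; rewrite /push mulSn ltn_add2r ltn_divLR // mulnC -expnS //.
Qed.

Lemma push_ge j x : j * n ^ depth <= push j x.
Proof. exact: leq_addl. Qed.

Lemma offset_le_states j : j <= n -> j * n ^ depth <= states.
Proof. by move=> jn; rewrite expnS leq_mul2r jn orbT. Qed.

(* States below j * n ^ depth are only compared with pushed states, which are
   not below it, so the update can be made in place. *)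
Lemma wp_choose s j : inputs s -> tables s ->
  nmem s v_p 0 = j * n ^ depth -> j < n ->
  wp prog_choose (4 * states + 2)
    (fun s' => forall x, x < j * n ^ depth ->
       rmem s' r_val x = Order.max (rmem s r_val x) (rmem s r_val (push j x))) s.
Proof.
move=> hi ht hp jn; have js := offset_le_states (ltnW jn).
eapply wp_le.
  apply/(wp_for (N := j * n ^ depth) (T := 2)
    (Inv := fun i s' => forall x, rmem s' r_val x =
       if (x < i)%N then Order.max (rmem s r_val x) (rmem s r_val (push j x))
       else rmem s r_val x)) => //=.
  - move=> i s' ij hs hv hI.
    have ht' := tables_same hs erefl ht.
    have hp' : nmem s' v_p 0 = j * n ^ depth by frame hs.
    have e1 : rmem s' r_val i = rmem s r_val i by rewrite hI ltnn.
    have e2 : rmem s' r_val (push j i) = rmem s r_val (push j i).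
      rewrite hI ltnNge (leq_trans (ltnW ij)) //; exact: push_ge.
    have si : i < states by apply: leq_trans ij js.
    have step (r : R) : r = Order.max (rmem s r_val i) (rmem s r_val (push j i)) ->
      forall x, (if x == i then r else rmem s' r_val x) =
        if x < i.+1 then Order.max (rmem s r_val x) (rmem s r_val (push j x))
        else rmem s r_val x.
      move=> -> x; have [->|ni] := eqVneq x i; first by rewrite leqnn.
      rewrite hI; congr (if _ then _ else _).
      by rewrite [RHS]ltnS [RHS]leq_eqVlt (negbTE ni).
    apply: wp_if => /=; rewrite hv hp' (tables_div ht') // -/(push j i) e1 e2 => hb.
      apply: wp_rset; rewrite /= /upd /= hv hp' (tables_div ht') // -/(push j i) e2.
      by apply: step; rewrite (max_idPr hb).
    apply: wp_skip => /= x; rewrite -(step (rmem s r_val i)); last first.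
      by rewrite max_l // ltW // ltNge.
    by case: eqP => [->|].
  - by move=> s' hs hI x xs; rewrite hI xs.
lia.
Qed.

Lemma wp_offset s t : inputs s -> tables s -> nmem s v_step 0 = t ->
  wp prog_offset (3 * n + 4) (fun s' => nmem s' v_j 0 = n.-1 - t /\
       nmem s' v_p 0 = (n.-1 - t) * n ^ depth) s.
Proof.
move=> hi ht hs; eapply wp_le.
  apply/wp_seq/wp_nset/wp_seq/wp_nset/(wp_for (N := n.-1 - t) (T := 1)
    (Inv := fun i s' => nmem s' v_p 0 = i * n ^ depth)) => //=.
  - by rewrite /upd /= inputs_n // hs; lia.
  - move=> i s' il hs' hv hI; apply: wp_nset; rewrite /= /upd /= hI.
    by frame hs'; rewrite /= /upd /= tables_top // mulSn addnC.
  - move=> s' hs' ->; split=> //; frame hs'; rewrite /= /upd /= inputs_n // hs.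
    by lia.
lia.
Qed.

Definition edge_time :=
  (3 * n + 4) + ((states * (n * (4 * depth.+1 + 4 * n + 8) + 6) + 2)
                 + (4 * states + 2)).

Lemma wp_edge s t : inputs s -> tables s -> 0 < depth ->
  (forall z, rmem s r_agg z = agg z) -> nmem s v_step 0 = t -> t < n.-1 ->
  (forall x, x < (n - t) * n ^ depth -> rmem s r_val x = best t x) ->
  wp prog_edge edge_time (fun s' => forall x, x < (n - t.+1) * n ^ depth ->
       rmem s' r_val x = best t.+1 x) s.
Proof.
move=> hi ht d0 hA hst tn hV; set j := n.-1 - t.
have jE : n - t.+1 = j by rewrite /j; lia.
have jE' : n - t = j.+1 by rewrite /j; lia.
have jn : j < n by rewrite /j; lia.
apply/wp_seq/(wp_weaken (wp_offset hi ht hst)) => // s1 hs1 [h1 h2].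
have hi1 := inputs_same hs1 erefl erefl hi.
have ht1 := tables_same hs1 erefl ht.
apply/wp_seq/(wp_weaken (wp_credits hi1 ht1 d0 _ h1 jn)) => //.
  by move=> z; frame hs1.
move=> s2 hs2 h3.
have hi2 := inputs_same hs2 erefl erefl hi1.
have ht2 := tables_same hs2 erefl ht1.
have hp2 : nmem s2 v_p 0 = j * n ^ depth by frame hs2.
apply: wp_weaken (wp_choose hi2 ht2 hp2 jn) _ _ => // s3 _ h4 x.
rewrite jE => xj; rewrite h4 //= -/j.
have js := offset_le_states (ltnW jn).
have js1 := offset_le_states jn.
have xs : x < states by apply: leq_trans xj js.
have ps := push_lt j xs.
rewrite !h3 // ?(leq_trans ps) //; frame hs1.
rewrite !hV ?jE' // ?[(credit _ _ + _)%R]addrC ?[(best _ _ + _)%R]addrC //.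
by apply: leq_trans xj _; rewrite leq_mul2r leqnSn orbT.
Qed.

Definition dp_time :=
  (depth.+1 * (3 * n + 6) + 3) + ((states * (4 * n + 5) + 3) +
   ((3 * k + 2) + ((n.-1 * (edge_time + 2) + 2) + 1))).

Lemma wp_dp s : inputs s -> nmem s v_L 0 = depth -> 0 < depth ->
  (forall z, rmem s r_agg z = 0%R) -> (forall x, rmem s r_val x = 0%R) ->
  wp prog_dp dp_time (fun s' => rmem s' 0 0 = best n.-1 0) s.
Proof.
move=> hi hL d0 hA hV.
apply/wp_seq/(wp_weaken (wp_pow hi hL)) => // s1 hs1 [h1 h2].
have hi1 := inputs_same hs1 erefl erefl hi.
apply/wp_seq/(wp_weaken (wp_tables hi1 _ h1 h2)) => //; first by frame hs1.
move=> s2 hs2 ht2.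
have hi2 := inputs_same hs2 erefl erefl hi1.
apply/wp_seq/(wp_weaken (wp_aggregate hi2 ht2 d0 _)) => //.
  by move=> z; frame hs2; frame hs1.
move=> s3 hs3 hA3.
have hi3 := inputs_same hs3 erefl erefl hi2.
have ht3 := tables_same hs3 erefl ht2.
apply/wp_seq/(wp_for (N := n.-1) (T := edge_time)
  (Inv := fun t s' => forall x, x < (n - t) * n ^ depth ->
     rmem s' r_val x = best t x)) => //=.
- by rewrite inputs_n // subn1.
- by move=> x _; frame hs3; frame hs2; frame hs1.
- move=> t s' tn hs hv hI.
  apply: wp_weaken (wp_edge _ _ d0 _ hv tn hI) _ _ => //.
  + exact: inputs_same hs erefl erefl hi3.
  + exact: tables_same hs erefl ht3.
  + by move=> z; frame hs.
- move=> s' hs hI; apply: wp_rset; rewrite /= /upd /= hI //.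
  by rewrite muln_gt0 expn_gt0 n_gt0 andbT; lia.
Qed.

Definition prog_time := 3 * k + 3 + (3 * k + 3 + (0 < depth) * dp_time).+1.

Lemma wp_prog s : inputs s ->
  (forall z, rmem s r_agg z = 0%R) -> (forall x, rmem s r_val x = 0%R) ->
  wp fza_prog prog_time
    (fun s' => rmem s' 0 0 =
       if 0 < depth then best n.-1 0 else (\sum_(i < k) w i * f 0)%R) s.
Proof.
move=> hi hA hV.
apply/wp_seq/(wp_weaken (wp_cap hi)) => // s1 hs1 h1.
have hi1 := inputs_same hs1 erefl erefl hi.
apply: wp_if; rewrite /= h1 -?ltnNge.
  rewrite leqn0 => /eqP d0; rewrite d0 /=.
  by apply: wp_weaken (wp_trivial hi1 _) _ _ => //; [frame hs1|lia].
move=> d0; rewrite d0.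
apply: wp_weaken (wp_dp hi1 h1 d0 _ _) _ _ => //; last by lia.
  by move=> z; frame hs1.
by move=> z; frame hs1.
Qed.

(** * Correctness of the dynamic program *)

(* The first entry is the least significant digit, hence the oldest cut. *)
Definition numeral (c : seq nat) := foldr (fun d a => d + n * a) 0 c.

Lemma numeral_cons d c : d < n ->
  (numeral (d :: c) %% n = d) * (numeral (d :: c) %/ n = numeral c).
Proof.
move=> dn; rewrite /= addnC mulnC modnMDl modn_small // divnMDl //.
by rewrite divn_small // addn0.
Qed.

Lemma numeral_rcons c d : numeral (rcons c d) = numeral c + d * n ^ size c.
Proof.
elim: c => [|x c IH] /=; first by rewrite muln0 addn0 expn0 muln1.
by rewrite IH expnS mulnDr addnA mulnCA.
Qed.

Lemma digits_above_numeral c l : all (fun d => d < n) c ->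
  digits_above (size c) l (numeral c) = count (fun d => l < d) c.
Proof.
by elim: c => //= d c IH /andP[dn cn]; rewrite !numeral_cons // IH.
Qed.

Lemma push_numeral j d c : d < n -> size c = depth ->
  push j (numeral (d :: c)) = numeral (rcons c j).
Proof. by move=> dn sc; rewrite /push numeral_cons // numeral_rcons sc. Qed.

Lemma count_drop_sorted l a d : sorted leq a ->
  count (fun x => l < x) (drop d a)
  = minn (size a - d) (count (fun x => l < x) a).
Proof.
elim: a d => [|x a IH] d //= hp.
have ha := path_sorted hp.
case: d => [|d] /=.
  by rewrite subn0; symmetry; apply/minn_idPr; rewrite -/(count _ (x :: a)) count_size.
rewrite IH // subSS; case: ltnP => [lx|//].
have /eqP -> : count (fun x => l < x) a == size a.
  rewrite -all_count; apply/allP => y ya.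
  apply: leq_trans lx _.
  exact: (allP (order_path_min leq_trans hp)).
by lia.
Qed.

Fixpoint state (F : nat -> bool) j :=
  if j is j'.+1 then if F j then push j (state F j') else state F j' else 0.

Definition cuts (F : nat -> bool) j := [seq x <- iota 1 j | F x].

Definition window F j := drop (size (cuts F j)) (nseq depth.+1 0 ++ cuts F j).

Lemma cutsS F j : cuts F j.+1 = cuts F j ++ (if F j.+1 then [:: j.+1] else [::]).
Proof.
rewrite /cuts; have -> : iota 1 j.+1 = iota 1 j ++ [:: j.+1].
  by rewrite -[j.+1]addn1 iotaD /= add1n addn1.
by rewrite filter_cat.
Qed.

Lemma size_window F j : size (window F j) = depth.+1.
Proof. by rewrite size_drop size_cat size_nseq addnK. Qed.

Lemma window_lt F j : j < n -> all (fun d => d < n) (window F j).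
Proof.
move=> jn; apply/allP => x /mem_drop; rewrite mem_cat => /orP[/nseqP[-> _]//|].
by rewrite mem_filter mem_iota => /and3P[_ _]; lia.
Qed.

Lemma state_window F j : j < n -> state F j = numeral (window F j).
Proof.
elim: j => [|j IH] jn.
  rewrite /window /= cats0; elim: depth => [|d IHd] /=; first by rewrite muln0.
  by move: IHd => /= <-; rewrite muln0.
have hw := window_lt F (ltnW jn); have := size_window F j.
rewrite /= IH 1?ltnW //; rewrite /window cutsS; case: ifP => Fj; last by rewrite cats0.
rewrite -/(window F j) size_cat addn1 catA.
case E: (window F j) hw => [//|d c] /andP[dn _] /= [sc].
rewrite push_numeral // -cats1; congr numeral.
have Ec : drop (size (cuts F j)) (nseq depth 0 ++ cuts F j) = c.
  by have := congr1 (drop 1) E; rewrite /window drop_drop add1n /= drop0.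
rewrite drop_cat -{}Ec size_cat size_nseq; case: ltnP => // h.
have d0 : depth = 0 by lia.
by rewrite d0 add0n subnn drop_size.
Qed.

Lemma cnt_state F j l : j < n ->
  cnt l (state F j) = minn depth.+1 (count (fun x => l < x) (cuts F j)).
Proof.
move=> jn; rewrite state_window // -{1}(size_window F j).
rewrite digits_above_numeral ?window_lt // count_drop_sorted.
  by rewrite size_cat size_nseq addnK count_cat count_nseq mul0n.
have : sorted leq (cuts F j).
  by apply: sorted_filter; [apply: leq_trans|apply: iota_sorted].
elim: depth.+1 => //= d IH hs; rewrite path_sortedE ?IH ?andbT //.
  by apply/allP.
exact: leq_trans.
Qed.

Lemma slot_inj i l j u : l < n -> j < n -> u < n -> i < k ->
  (slot i == (l * n + j) * n + u) =
  [&& lft i - 1 == l, rgt i == j & cap i == u].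
Proof.
move=> ln jn un ik; have cn : cap i < n by rewrite /cap; lia.
apply/eqP/and3P => [|[/eqP <- /eqP <- /eqP <-] //].
rewrite /slot => E; have E1 := congr1 (modn^~ n) E; have E2 := congr1 (divn^~ n) E.
rewrite /= !modnMDl !modn_small // in E1.
rewrite /= !divnMDl // !(divn_small cn) // !(divn_small un) !addn0 in E2.
have E3 := congr1 (modn^~ n) E2; have E4 := congr1 (divn^~ n) E2.
rewrite /= !modnMDl !modn_small ?rgtP // in E3.
rewrite /= !divnMDl // !divn_small ?rgtP // !addn0 in E4.
by split; apply/eqP.
Qed.

Lemma creditE j x : j < n ->
  credit j x = (\sum_(i < k | rgt i == j)
    if (cnt (lft i - 1) x <= cap i)%N then w i * f (cnt (lft i - 1) x)
    else 0)%R.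
Proof.
move=> jn; rewrite /credit /credit_row /agg.
transitivity (\sum_(l < n) \sum_(u < n) \sum_(i < k)
  if [&& lft i - 1 == l, rgt i == j & cap i == u]%N then
    if (cnt l x <= u)%N then w i * f (cnt l x) else 0 else 0)%R.
  apply: eq_bigr => l _; apply: eq_bigr => u _; rewrite -big_mkcond /=.
  under [in RHS]eq_bigl => i do rewrite -slot_inj //.
  case: ifP => _; last by rewrite big1.
  by rewrite mulr_suml.
under eq_bigr => l _ do rewrite exchange_big /=.
rewrite exchange_big /= [RHS]big_mkcond /=; apply: eq_bigr => i _.
have cn : cap i < n by rewrite /cap; lia.
rewrite (bigD1 (Ordinal (lftP (ltn_ord i)))) //= [X in (_ + X)%R]big1 ?addr0; last first.
  move=> l nl; rewrite big1 // => u _; case: and3P => // -[/eqP e _ _].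
  by case/eqP: nl; apply: val_inj.
rewrite (bigD1 (Ordinal cn)) //= [X in (_ + X)%R]big1 ?addr0; last first.
  move=> u nu; case: and3P => // -[_ _ /eqP e].
  by case/eqP: nu; apply: val_inj.
by rewrite !eqxx andbT.
Qed.

Definition gain F j := credit j (state F j).

Lemma best_ge F t : t < n ->
  (\sum_(n - t <= j < n) gain F j <= best t (state F (n.-1 - t)))%R.
Proof.
elim: t => [|t IH] tn /=; first by rewrite subn0 big_geq.
have Ej : n - t.+1 = (n.-1 - t.+1).+1 by lia.
have Ej' : n.-1 - t = (n.-1 - t.+1).+1 by lia.
rewrite Ej big_ltn; last by lia.
have -> : (n.-1 - t.+1).+2 = n - t by lia.
have {}IH := IH (ltnW tn); rewrite Ej'.
rewrite le_max /gain; rewrite Ej' /= in IH *.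
by case: ifP IH => _ IH; apply/orP; [right|left]; rewrite lerD2l.
Qed.

Lemma eq_state F F' j : {in iota 1 j, F =1 F'} -> state F j = state F' j.
Proof.
elim: j => [//|j IH] h.
have hj : F j.+1 = F' j.+1 by apply: h; rewrite mem_iota; lia.
by rewrite /= hj IH // => x hx; apply: h; move: hx; rewrite !mem_iota; lia.
Qed.

Lemma best_attained F t : t < n -> exists2 F',
  {in iota 1 (n.-1 - t), F =1 F'} &
  best t (state F (n.-1 - t)) = (\sum_(n - t <= j < n) gain F' j)%R.
Proof.
elim: t F => [|t IH] F tn /=.
  by exists F => //; rewrite subn0 big_geq.
have Ej : n - t.+1 = (n.-1 - t.+1).+1 by lia.
have Ej' : n.-1 - t = (n.-1 - t.+1).+1 by lia.
pose F1 b x := if x == n.-1 - t then b else F x.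
have hF1 b : {in iota 1 (n.-1 - t.+1), F =1 F1 b}.
  by move=> x; rewrite mem_iota /F1; case: eqP => //; lia.
have [b hb] : exists b, best t.+1 (state F (n.-1 - t.+1))
    = (credit (n.-1 - t) (state (F1 b) (n.-1 - t))
       + best t (state (F1 b) (n.-1 - t)))%R.
  have E b : state (F1 b) (n.-1 - t) = if b then
     push (n.-1 - t) (state F (n.-1 - t.+1)) else state F (n.-1 - t.+1).
    by rewrite (eq_state (hF1 b)) Ej' /= {1}/F1 Ej' eqxx.
  rewrite /= /Order.max; case: ifP => _; [exists true|exists false]; by rewrite E.
have [F' h1 h2] := IH (F1 b) (ltnW tn).
exists F'.
  move=> x hx; rewrite (hF1 b) //; apply: h1; move: hx; rewrite !mem_iota; lia.
rewrite -[LHS]/(best t.+1 _) hb h2 Ej [RHS]big_ltn; last by lia.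
have -> : (n.-1 - t.+1).+2 = n - t by lia.
by rewrite /gain -Ej' (eq_state h1).
Qed.

Definition cut_revenue F : R := (\sum_(i < k)
  let c := count (fun x => (lft i - 1 < x)%N) (cuts F (rgt i)) in
  if (c <= uu i)%N then w i * f c else 0)%R.

Lemma cap_le_depth (i : 'I_k) : cap i <= depth.
Proof. exact: (leq_bigmax i). Qed.

Hypothesis rgt_gt0 : forall i, i < k -> 0 < rgt i.

Lemma cut_revenue_gain F : cut_revenue F = (\sum_(1 <= j < n) gain F j)%R.
Proof.
rewrite /gain (eq_big_nat _ _ (F2 := fun j => (\sum_(i < k | rgt i == j)
    let c := count (fun x => (lft i - 1 < x)%N) (cuts F (rgt i)) in
  if (c <= uu i)%N then w i * f c else 0)%R)); last first.
  move=> j /andP[_ jn]; rewrite creditE //; apply: eq_bigr => i /eqP e.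
  rewrite cnt_state // e /=; set c := count _ _.
  have cn : c <= n.-1.
    rewrite /c (leq_trans (count_size _ _)) // size_filter.
    by rewrite (leq_trans (count_size _ _)) // size_iota; lia.
  have := cap_le_depth i; rewrite /cap => hcap.
  have -> : (minn depth.+1 c <= minn (uu i) n.-1) = (c <= uu i) by lia.
  by case: ifP => // hc; have -> : minn depth.+1 c = c by lia.
rewrite (exchange_big_dep xpredT) //=; apply: eq_bigr => i _.
under eq_bigl => j do rewrite eq_sym.
by rewrite big_nat1_eq rgt_gt0 ?rgtP.
Qed.

Lemma cut_revenue_le_best F : (cut_revenue F <= best n.-1 0)%R.
Proof.
have := @best_ge F n.-1; rewrite subnn cut_revenue_gain prednK // leqnn => /(_ isT).
by have -> : n - n.-1 = 1 by lia.
Qed.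

Lemma best_cut_revenue : exists F, best n.-1 0 = cut_revenue F.
Proof.
have [|F _] := @best_attained xpred0 n.-1; first by lia.
rewrite subnn /=; have -> : n - n.-1 = 1 by lia.
by rewrite -cut_revenue_gain; exists F.
Qed.

Lemma cut_revenue_depth0 F : depth = 0 -> (forall c, 0 <= f c)%R ->
  (forall i, 0 <= w i)%R -> (cut_revenue F <= cut_revenue xpred0)%R.
Proof.
move=> d0 f0 w0; apply: ler_sum => i _.
have := cap_le_depth i; rewrite d0 /cap => hc.
have := rgtP (ltn_ord i); have := rgt_gt0 (ltn_ord i) => r0 rn.
have -> : uu i = 0 by lia.
rewrite leqn0 /=; case: eqP => [->|_]; rewrite /cuts filter_pred0 //=.
exact: mulr_ge0.
Qed.

Lemma cut_revenue0 : cut_revenue xpred0 = (\sum_(i < k) w i * f 0)%R.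
Proof. by apply: eq_bigr => i _; rewrite /cuts filter_pred0 /=. Qed.

End Program.

(** * FZA instances *)

Section Instance.
Variables (R : realType) (I : fza_path R).

Local Notation n := (fza_n I).
Local Notation k := (fza_k I).

Definition inst_lft i := nth 0 (fza_nat_input I 1) i.
Definition inst_rgt i := nth 0 (fza_nat_input I 2) i.
Definition inst_u i := nth 0 (fza_nat_input I 3) i.
Definition inst_f i := nth 0%R (fza_real_input I 0) i.
Definition inst_w i := nth 0%R (fza_real_input I 1) i.

Local Notation depth_I := (depth n k inst_u).
Local Notation cut_revenue_I := (cut_revenue k inst_lft inst_rgt inst_u inst_f inst_w).
Local Notation best_I := (best n k inst_lft inst_rgt inst_u inst_f inst_w).

Lemma nth_map_enum_ord (T : Type) (x0 : T) (g : 'I_k -> T) (i : 'I_k) :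
  nth x0 [seq g j | j <- enum 'I_k] i = g i.
Proof. by rewrite (nth_map i) ?size_enum_ord // nth_ord_enum. Qed.

Lemma inst_lftE (i : 'I_k) : inst_lft i = (fza_left i).+1.
Proof. exact: nth_map_enum_ord. Qed.

Lemma inst_rgtE (i : 'I_k) : inst_rgt i = (fza_right i).+1.
Proof. exact: nth_map_enum_ord. Qed.

Lemma inst_uE (i : 'I_k) : inst_u i = fza_u i.
Proof. exact: nth_map_enum_ord. Qed.

Lemma inst_wE (i : 'I_k) : inst_w i = ((fza_w i)%:R)%R.
Proof. exact: (nth_map_enum_ord 0%R). Qed.

Lemma inst_fE d : d < n -> inst_f d = fza_f I d.
Proof. exact: nth_mkseq. Qed.

Lemma inst_f_ge0 d : (0 <= inst_f d)%R.
Proof.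
have [dn|nd] := ltnP d n; first by rewrite inst_fE // fza_f_ge0.
by rewrite /inst_f nth_default // -[fza_real_input I 0]/(mkseq (fza_f I) n) size_mkseq.
Qed.

Lemma inst_w_ge0 i : (0 <= inst_w i)%R.
Proof.
have [ik|ki] := ltnP i k; first by rewrite (inst_wE (Ordinal ik)) ler0n.
by rewrite /inst_w nth_default //= size_map size_enum_ord.
Qed.

Lemma inst_lft_lt i : i < k -> inst_lft i - 1 < n.
Proof.
move=> ik; rewrite (inst_lftE (Ordinal ik)) subn1.
exact: leq_trans (ltn_ord _) (leqnSn _).
Qed.

Lemma inst_rgt_lt i : i < k -> inst_rgt i < n.
Proof. by move=> ik; rewrite (inst_rgtE (Ordinal ik)) ltnS. Qed.

Lemma inst_rgt_gt0 i : i < k -> 0 < inst_rgt i.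
Proof. by move=> ik; rewrite (inst_rgtE (Ordinal ik)). Qed.

Definition cut_set (F : nat -> bool) : {set 'I_(fza_m I)} :=
  [set y : 'I_(fza_m I) | F y.+1].

Lemma cut_setK (S : {set 'I_(fza_m I)}) :
  cut_set (fun x => [exists y in S, x == y.+1]) = S.
Proof.
apply/setP => y; rewrite inE; apply/existsP/idP => [[z /andP[zS /eqP[e]]]|yS].
  by rewrite (val_inj e).
by exists y; rewrite yS /=.
Qed.

Lemma count_cuts F (i : 'I_k) :
  count (fun x => inst_lft i - 1 < x) (cuts F (inst_rgt i))
  = #|fza_P i :&: cut_set F|.
Proof.
rewrite inst_lftE inst_rgtE subn1 [_.+1.-1]/= /cuts count_filter.
rewrite -[iota 1 _]/(iota (1 + 0) _) iotaDl count_map.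
rewrite -sum1_count -[in iota 0 _](subn0 (fza_right i).+1) -/(index_iota 0 _).
rewrite (big_nat_widen _ _ (fza_m I)) // big_mkord -sum1_card; apply: eq_bigl => y.
by rewrite !inE /= add1n !ltnS andbAC.
Qed.

Lemma cut_revenueE F : cut_revenue_I F = revenue (cut_set F).
Proof.
apply: eq_bigr => i _; rewrite /= count_cuts inst_uE inst_wE /rev.
rewrite inst_fE // ltnS (leq_trans (max_card _)) //.
by rewrite card_ord.
Qed.

Lemma opt_revenue_unique v :
  (forall F, cut_revenue_I F <= v)%R -> (exists F, v = cut_revenue_I F) -> opt_revenue I = v.
Proof.
move=> ub [F vE]; have ub' (S : {set 'I_(fza_m I)}) : (revenue S <= v)%R.
  by rewrite -(cut_setK S) -cut_revenueE.
apply/le_anti/andP; split; first by apply: bigmax_le => // S _.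
by rewrite vE cut_revenueE; apply: le_bigmax.
Qed.

Lemma opt_revenueE : opt_revenue I =
  if 0 < depth_I then best_I n.-1 0 else (\sum_(i < k) inst_w i * inst_f 0)%R.
Proof.
case: ltnP => [d0|d0].
  apply: opt_revenue_unique => [F|].
    by apply: cut_revenue_le_best => //; [apply: inst_lft_lt|apply: inst_rgt_lt
      |apply: inst_rgt_gt0].
  apply: best_cut_revenue => //; [exact: inst_lft_lt|exact: inst_rgt_lt
    |exact: inst_rgt_gt0].
rewrite -(cut_revenue0 k inst_lft inst_rgt inst_u inst_f inst_w).
apply: opt_revenue_unique => [F|]; last by eexists.
apply: (@cut_revenue_depth0 _ n) => //.
- exact: inst_rgt_lt.
- exact: inst_rgt_gt0.
- by apply/eqP; rewrite -leqn0.
- exact: inst_f_ge0.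
- exact: inst_w_ge0.
Qed.

(* Any large enough constant works. *)
Definition time_const := 100.

Lemma prog_time_le :
  prog_time n k inst_u <= time_const * (k + n ^ (time_const * umax I)).
Proof.
have d_u : depth_I <= umax I.
  apply/bigmax_leqP => i _; rewrite /cap inst_uE (leq_trans (geq_minl _ _)) //.
  exact: (leq_bigmax i).
have d_n : depth_I < n.
  by rewrite /fza_n ltnS; apply/bigmax_leqP => i _; apply: geq_minr.
have n0 : 0 < n by [].
have P0 : 0 < n ^ (time_const * umax I) by rewrite expn_gt0.
rewrite /prog_time; case: (ltnP 0 depth_I) => d0; last first.
  by rewrite mul0n /time_const; lia.
rewrite mul1n /dp_time /edge_time.
have KP : (n ^ depth_I.+1) ^ 4 <= n ^ (time_const * umax I).
  rewrite -expnM leq_pexp2l // /time_const; lia.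
have nK : n <= n ^ depth_I.+1 by rewrite -{1}[n]expn1 leq_pexp2l.
move: (n ^ depth_I.+1) (n ^ (time_const * umax I)) nK KP P0 => K P nK KP P0.
set d := depth_I.+1.
have dK : d <= K by apply: leq_trans nK.
have K0 : 0 < K by apply: leq_trans nK.
have h1 : d * (3 * n + 6) <= K * (9 * K) by apply: leq_mul => //; lia.
have h2 : K * (4 * n + 5) <= K * (9 * K) by apply: leq_mul => //; lia.
have h3 : n * (4 * d + 4 * n + 8) <= K * (16 * K) by apply: leq_mul => //; lia.
have h4 : K * (n * (4 * d + 4 * n + 8) + 6) <= K * (22 * (K * K)).
  by apply: leq_mul => //; nia.
set E := 3 * n + 4 + _.
have KK : K <= K * (K * K) by rewrite leq_pmulr // muln_gt0 K0.
have hE : E + 2 <= 45 * (K * (K * K)) by rewrite /E; lia.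
have h5 : n.-1 * (E + 2) <= K * (45 * (K * (K * K))).
  by apply: leq_mul => //; lia.
have KE : K ^ 4 = K * (K * (K * K)) by [].
have K2 : K * K <= K ^ 4 by rewrite KE leq_mul2l KK orbT.
rewrite /time_const; move: KP; rewrite KE in K2 *; lia.
Qed.

Lemma wp_fza s : (forall a i, nmem s a i = nmem (fza_input I) a i) ->
  (forall a i, a != 2 -> rmem s a i = rmem (fza_input I) a i) ->
  wp fza_prog (time_const * (k + n ^ (time_const * umax I)))
    (fun s' => rmem s' 0 0 = opt_revenue I) s.
Proof.
move=> hn hr; rewrite opt_revenueE.
have inp : inputs n k inst_lft inst_rgt inst_u inst_f inst_w s.
  by split=> *; rewrite ?hn ?hr.
apply: wp_le prog_time_le.
apply: wp_prog inp _ _ => //.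
- exact: inst_lft_lt.
- exact: inst_rgt_lt.
- by move=> z; rewrite hr //= nth_nil.
- by move=> z; rewrite hr //= nth_nil.
Qed.

Lemma sub_revenue_full (F : {set 'I_(fza_m I)}) : sub_revenue (fza_n I).-1 F = revenue F.
Proof.
rewrite /sub_revenue /revenue; apply: eq_big => [i|i _]; first exact: ltn_ord.
suff -> : fza_P i :&: edges_upto I (fza_n I).-1 = fza_P i by [].
by apply/setP => x; rewrite !inE ltn_ord andbT.
Qed.

Lemma size_rightmost_cuts j F : size (rightmost_cuts (I := I) j F) = (umax I).+1.
Proof.
rewrite /rightmost_cuts; set s := [seq _ <- _ | _].
rewrite size_drop subKn //.
rewrite size_filter.
apply: (@leq_trans (count (preim val (fun p => p <= umax I))
                      (enum 'I_(umax I + n)))).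
  rewrite -count_map val_enum_ord /fza_n addnS -addSn iotaD count_cat.
  suff /eqP -> : count (fun p => p <= umax I) (iota 0 (umax I).+1) == (umax I).+1.
    exact: leq_addr.
  rewrite -[X in _ == X](size_iota 0) -all_count.
  by apply/allP => p; rewrite mem_iota.
apply: sub_count => p /= pu; rewrite /is_cut pu /=.
exact: leq_trans pu (leq_addr _ _).
Qed.

Lemma opt_revenue_rightmost_cuts :
  (opt_revenue I)%:E =
  \big[maxe/-oo%E]_(c : ((umax I).+1).-tuple (ext_edge I)) Rmax (fza_n I).-1 c.
Proof.
apply/le_anti/andP; split.
  have [F ->] : exists F : {set 'I_(fza_m I)}, opt_revenue I = revenue F.
    rewrite /opt_revenue; elim/big_ind: _.
    - by exists set0.
    - move=> x y [F ->] [G ->]; rewrite /Order.max; case: ifP => _;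
        by [exists F|exists G].
    - by move=> F _; exists F.
  pose c := Tuple (introT eqP (size_rightmost_cuts (fza_n I).-1 F)).
  apply: le_trans (le_bigmax _ _ c).
  rewrite -sub_revenue_full; rewrite /Rmax.
  apply: (le_bigmax_cond _ (fun G => (sub_revenue (fza_n I).-1 G)%:E)).
  rewrite eqxx andbT; apply/subsetP => x _; rewrite inE; exact: ltn_ord.
apply: bigmax_le => [|c _]; first exact: leNye.
apply: bigmax_le => [|F _]; first exact: leNye.
by rewrite lee_fin sub_revenue_full; apply: le_bigmax.
Qed.

End Instance.

Definition decide_prog :=
  Seq fza_prog
    (If (RLe (RGet 2 (NConst 0)) (RGet 0 (NConst 0)))
       (NSet 0 (NConst 0) (NConst 1)) (NSet 0 (NConst 0) (NConst 0))).

Lemma time_le_size_exp n k e C :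
  C * (k + n ^ e) <= (2 + n + 4 * k) ^ (C + e + 2).
Proof.
set S := 2 + n + 4 * k.
have S2 : 1 < S by rewrite /S; lia.
have h1 : C <= S ^ C by apply/ltnW/ltn_expl.
have h2 : n ^ e <= S ^ e by case: e => [//|e]; rewrite leq_exp2r // /S; lia.
have h3 : 0 < S ^ e by rewrite expn_gt0 ltnW.
rewrite -addnA expnD; apply: leq_mul => //.
have kS : k <= S by rewrite /S; lia.
apply: (@leq_trans (S ^ e * S + S ^ e * S)).
  apply: leq_add; first exact: leq_trans kS (leq_pmull _ h3).
  by apply: leq_trans h2 (leq_pmulr _ (ltnW S2)).
by rewrite addnn -mul2n mulnC expnD -mulnA leq_mul2l leq_mul2l S2 !orbT.
Qed.

Lemma exists_revenue_ge (R : realType) (I : fza_path R) (K : R) :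
  [exists F : {set 'I_(fza_m I)}, (K <= revenue F)%R] = (K <= opt_revenue I)%R.
Proof.
apply/existsP/idP => [[F KF]|].
  by apply: le_trans KF _; apply: le_bigmax.
rewrite /opt_revenue; elim/big_ind: _ => [h|x y hx hy|F _ h].
- by exists set0.
- by rewrite le_max => /orP[/hx|/hy].
- by exists F.
Qed.

Theorem theorem6 (R : realType) :
  (forall I : fza_path R,
     (opt_revenue I)%:E =
     \big[maxe/-oo%E]_(c : ((umax I).+1).-tuple (ext_edge I))
        Rmax (fza_n I).-1 c)
  /\
  (exists (p : cmd) (C : nat), forall I : fza_path R,
     exists (t : nat) (s : memory R),
       [/\ exec p (fza_input I) t s,
           (rmem s 0%N 0%N)%:E =
           \big[maxe/-oo%E]_(c : ((umax I).+1).-tuple (ext_edge I))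
              Rmax (fza_n I).-1 c
         & (t <= C * (fza_k I + fza_n I ^ (C * umax I)))%N])
  /\
  (in_XP (FZA_paths R) /\ in_XP (FZA_paths_dec R)).
Proof.
split; first exact: opt_revenue_rightmost_cuts.
have H (I : fza_path R) := @wp_fza R I (fza_input I) (fun _ _ => erefl) (fun _ _ _ => erefl).
split; last split.
- exists fza_prog, time_const => I; have [t [s [h1 h2 h3]]] := H I.
  by exists t, s; split=> //; rewrite h3; apply: opt_revenue_rightmost_cuts.
- exists fza_prog, (fun u => time_const + time_const * u + 2) => I.
  have [t [s [h1 h2 h3]]] := H I.
  by exists t, s; split=> //; apply: leq_trans h2 (time_le_size_exp _ _ _ _).
- exists decide_prog, (fun u => time_const.+2 + time_const * u + 2) => -[I K].
  set s0 := pp_input _.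
  have [||t [s [h1 h2 h3]]] := @wp_fza R I s0.
  + by [].
  + by move=> a i /negbTE a2; rewrite /= /upd a2.
  have h4 : rmem s 2 0 = K by rewrite (exec_same h1).2.
  pose b := (K <= opt_revenue I)%R.
  exists (t + 2), (set_nat s 0 0 b); split.
  + apply: ExecSeq h1 _; rewrite /b; case: (boolP (_ <= _)%R) => hb.
      apply: ExecIfTrue; first by rewrite /= h4 h3.
      exact: ExecNSet.
    apply: ExecIfFalse; first by rewrite /= h4 h3.
    exact: ExecNSet.
  + by rewrite /= /upd /= exists_revenue_ge.
  + rewrite /=; apply: (@leq_trans (fza_size I ^ (time_const.+2 + time_const * umax I + 2))).
      apply: leq_trans (time_le_size_exp _ _ _ _).
      have : 0 < fza_n I ^ (time_const * umax I) by rewrite expn_gt0.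
      move: h2; set P := _ ^ _; lia.
    by rewrite leq_exp2r //; lia.
Qed.
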